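(* For every dimension $n\geq 14$, there exists an Anosov Lie algebra $\mathfrak{n}^{\mathbb{Q}}$ of dimension $n$ with no positive grading.
   Context: An automorphism of a finite-dimensional rational Lie algebra is called an Anosov automorphism if it is hyperbolic (no complex eigenvalue of absolute value $1$) and integer-like (its characteristic polynomial has integer coefficients and its determinant is $\pm1$). An Anosov Lie algebra is a finite-dimensional nilpotent Lie algebra over $\mathbb{Q}$ admitting an Anosov automorphism. A positive grading on a Lie algebra $\mathfrak{n}$ is a vector space decomposition $\mathfrak{n}=\bigoplus_{i>0}\mathfrak{n}_i$ indexed by the positive integers with $[\mathfrak{n}_i,\mathfrak{n}_j]\subset\mathfrak{n}_{i+j}$ for all $i,j$. *)

(* Defs.v *)
From mathcomp Require Import all_boot all_order all_algebra all_field.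

Set Implicit Arguments.
Unset Strict Implicit.
Unset Printing Implicit Defensive.

Import GRing.Theory Num.Theory.
Local Open Scope ring_scope.

Record lieAlgebra (K : fieldType) := LieAlgebra {
  lie_space :> vectType K;
  lie_bracket : {bilinear lie_space -> lie_space -> lie_space};
  lie_alternating : forall x, lie_bracket x x = 0;
  lie_jacobi : forall x y z,
    lie_bracket x (lie_bracket y z) + lie_bracket y (lie_bracket z x)
      + lie_bracket z (lie_bracket x y) = 0 }.

Arguments lie_bracket {K} l.

Section LieAlgebraTheory.

Variables (K : fieldType) (L : lieAlgebra K).

(* By bilinearity this is the span of all [x, y] with x in U and y in V, as for
   the product prodv of subspaces of an algebra. *)
Definition lie_prodv (U V : {vspace L}) : {vspace L} :=
  <<allpairs (lie_bracket L) (vbasis U) (vbasis V)>>%VS.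

Fixpoint lower_central (k : nat) : {vspace L} :=
  if k is k'.+1 then lie_prodv fullv (lower_central k') else fullv.

Definition lie_nilpotent : Prop := exists k : nat, lower_central k = 0%VS.

Definition lie_automorphism (f : 'End(L)) : Prop :=
  bijective f /\
  forall x y : L, f (lie_bracket L x y) = lie_bracket L (f x) (f y).

(* The grading is indexed by nat with the component of degree 0 required to be
   zero. The first two conditions say that L is the internal direct sum of the
   infinite family (n_i): its finite subfamilies are independent and every
   vector is a finite sum of homogeneous ones. *)
Definition positive_grading (n_ : nat -> {vspace L}) : Prop :=
  [/\ forall N : nat, directv (\sum_(i < N) n_ i)%VS,
      forall x : L, exists N : nat, x \in (\sum_(i < N) n_ i)%VS,
      n_ 0%N = 0%VS &
      forall (i j : nat) (x y : L), x \in n_ i -> y \in n_ j ->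
        lie_bracket L x y \in n_ (i + j)%N].

End LieAlgebraTheory.

(* The matrix acts on row vectors. The characteristic polynomial, determinant
   and eigenvalues do not depend on the basis. *)
Definition lfun_matrix (K : fieldType) (V : vectType K) (f : 'End(V)) :
    'M[K]_(\dim {:V}) :=
  passmx.mxof (vbasis {:V}) (vbasis {:V}) f.

(* The complex eigenvalues of a rational matrix are algebraic numbers, so they
   all lie in algC. *)
Definition hyperbolic (V : vectType rat) (f : 'End(V)) : Prop :=
  forall z : algC, eigenvalue (map_mx ratr (lfun_matrix f)) z -> `|z| != 1.

Definition integer_like (V : vectType rat) (f : 'End(V)) : Prop :=
  char_poly (lfun_matrix f) \is a polyOver Num.int /\
  (\det (lfun_matrix f) = 1 \/ \det (lfun_matrix f) = -1).

Definition anosov_automorphism (L : lieAlgebra rat) (f : 'End(L)) : Prop :=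
  [/\ lie_automorphism f, hyperbolic f & integer_like f].

Definition anosov_lie_algebra (L : lieAlgebra rat) : Prop :=
  lie_nilpotent L /\ exists f : 'End(L), anosov_automorphism f.

(* Main.v *)
Require Import Defs.
From HB Require Import structures.
From mathcomp Require Import all_boot all_order all_algebra all_field.
From mathcomp Require Import ring lra.

(* Let K = Q(l) with l^2 = 3 l - 1, so that l is a unit of norm 1 in a real
   quadratic field, and let R = K[s, t]/(s^2, t^2). The abelian Lie algebra K^2
   acts on R: the pair (a, b) acts as multiplication by a s + b t + conj(a) st.
   The example is the rational Lie algebra K^2 |x R, plus an abelian summand Q^m
   which adjusts the dimension to 12 + m.

   Multiplication by l and l^-2 on the two coordinates of K^2, by l^3, l^4, l
   and l^2 on the coefficients of 1, s, t and st in R, and by the companion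
   matrix of X^m + 3 X^(m-1) + 1 on Q^m, is an Anosov automorphism.

   A derivation D acts on the quotient K^2 by Q-linear maps; comparing the s and
   t coefficients in D[x, y] = [Dx, y] + [x, Dy] makes them K-linear (K has no
   nonzero derivation) and diagonal, say (A, B), and the st coefficient then
   forces conj(A) = A + B. Hence B has trace 0 over Q. A positive grading would
   yield a derivation for which B has a positive integer as an eigenvalue, but
   an element of trace 0 is a rational multiple of 2 l - 3 = sqrt 5. *)

Set Implicit Arguments.
Unset Strict Implicit.
Unset Printing Implicit Defensive.

Import Order.TTheory GRing.Theory Num.Theory passmx.
Local Open Scope ring_scope.

(** * The quadratic field *)

(* Quad a b stands for a + b l with l ^ 2 = 3 l - 1. *)
Record quad := Quad { qcst : rat; qlin : rat }.

Definition pair_of_quad (x : quad) := (qcst x, qlin x).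
Definition quad_of_pair (x : rat * rat) := Quad x.1 x.2.
Lemma pair_of_quadK : cancel pair_of_quad quad_of_pair.
Proof. by case. Qed.
HB.instance Definition _ := Choice.copy quad (can_type pair_of_quadK).

Lemma quadP (x y : quad) : qcst x = qcst y -> qlin x = qlin y -> x = y.
Proof. by case: x y => [a b] [c d] /= -> ->. Qed.

Definition quad_add (x y : quad) := Quad (qcst x + qcst y) (qlin x + qlin y).
Definition quad_opp (x : quad) := Quad (- qcst x) (- qlin x).
Definition quad_mul (x y : quad) :=
  Quad (qcst x * qcst y - qlin x * qlin y)
       (qcst x * qlin y + qlin x * qcst y + qlin x * qlin y *+ 3).
Definition quad_scale (k : rat) (x : quad) := Quad (k * qcst x) (k * qlin x).

Ltac quad_ring := move=> *; apply: quadP => /=; ring.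

Lemma quad_addA : associative quad_add. Proof. quad_ring. Qed.
Lemma quad_addC : commutative quad_add. Proof. quad_ring. Qed.
Lemma quad_add0 : left_id (Quad 0 0) quad_add. Proof. quad_ring. Qed.
Lemma quad_addN : left_inverse (Quad 0 0) quad_opp quad_add.
Proof. quad_ring. Qed.
HB.instance Definition _ :=
  GRing.isZmodule.Build quad quad_addA quad_addC quad_add0 quad_addN.

Lemma quad_mulA : associative quad_mul. Proof. quad_ring. Qed.
Lemma quad_mulC : commutative quad_mul. Proof. quad_ring. Qed.
Lemma quad_mul1 : left_id (Quad 1 0) quad_mul. Proof. quad_ring. Qed.
Lemma quad_mulDl : left_distributive quad_mul +%R. Proof. quad_ring. Qed.
HB.instance Definition _ := GRing.Zmodule_isComNzRing.Build quad
  quad_mulA quad_mulC quad_mul1 quad_mulDl isT.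

Lemma quad_scaleA (a b : rat) (x : quad) :
  quad_scale a (quad_scale b x) = quad_scale (a * b) x.
Proof. quad_ring. Qed.
Lemma quad_scale1 : left_id 1 quad_scale. Proof. quad_ring. Qed.
Lemma quad_scaleDr : right_distributive quad_scale +%R. Proof. quad_ring. Qed.
Lemma quad_scaleDl (x : quad) : {morph quad_scale^~ x : a b / a + b}.
Proof. quad_ring. Qed.
HB.instance Definition _ := GRing.Zmodule_isLmodule.Build rat quad
  quad_scaleA quad_scale1 quad_scaleDr quad_scaleDl.

Lemma quad_scaleAl (k : rat) (x y : quad) : k *: (x * y) = (k *: x) * y.
Proof. quad_ring. Qed.
HB.instance Definition _ :=
  GRing.Lmodule_isLalgebra.Build rat quad quad_scaleAl.
HB.instance Definition _ := GRing.Lalgebra_isComAlgebra.Build rat quad.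

Definition quad_row (x : quad) : 'rV[rat]_2 := \row_i [:: qcst x; qlin x]`_i.
Lemma quad_row_linear : linear quad_row.
Proof. by move=> k x y; apply/rowP => -[[|[|]]] // ?; rewrite !mxE. Qed.
HB.instance Definition _ :=
  GRing.isLinear.Build rat quad 'rV[rat]_2 _ quad_row quad_row_linear.
Lemma quad_row_bij : bijective quad_row.
Proof.
exists (fun v : 'rV_2 => Quad (v 0 ord0) (v 0 ord_max)) => [[a b]|v].
  by rewrite !mxE.
by apply/rowP => -[[|[|]]] // ?; rewrite mxE /=; congr (v 0 _); apply: val_inj.
Qed.
Fact quad_vect_iso : Vector.axiom 2 quad.
Proof. by exists quad_row; [apply: quad_row_linear | apply: quad_row_bij]. Qed.
HB.instance Definition _ := Lmodule_hasFinDim.Build rat quad quad_vect_iso.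

Definition qgen : quad := Quad 0 1.
(** The nontrivial automorphism of K: it sends l to 3 - l, which is also the inverse of l. *)
Definition qconj (x : quad) := Quad (qcst x + qlin x *+ 3) (- qlin x).

Lemma qconj_linear : linear qconj.
Proof. move=> k x y; quad_ring. Qed.
HB.instance Definition _ :=
  GRing.isLinear.Build rat quad quad _ qconj qconj_linear.
Lemma qconj_monoid : monoid_morphism qconj.
Proof. by split=> [|x y]; quad_ring. Qed.
HB.instance Definition _ :=
  GRing.isMonoidMorphism.Build quad quad qconj qconj_monoid.

Lemma scale_quadE (k : rat) (x : quad) : k *: x = Quad k 0 * x.
Proof. quad_ring. Qed.

(** * The Lie algebra *)

Section Algebra.

Variable m : nat.

(* The pair (ca, cb) is the coordinate on K^2, the element of R is
   cz + cp s + cq t + cw st, and cr is the coordinate on the summand Q^m. *)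
Record carrier := Vec {
  ca : quad; cb : quad; cz : quad; cp : quad; cq : quad; cw : quad;
  cr : 'rV[rat]_m }.
Implicit Types x y : carrier.

Lemma carrierP x y :
  ca x = ca y -> cb x = cb y -> cz x = cz y -> cp x = cp y -> cq x = cq y ->
  cw x = cw y -> cr x = cr y -> x = y.
Proof. by case: x y => [a b z p q w r] [] /= *; congr Vec. Qed.

(** The record gets its finite dimension by transport from this iterated product, on which
    characteristic polynomials are computed factor by factor. *)
Definition prod_carrier : vectType rat :=
  (quad * (quad * (quad * (quad * (quad * (quad * 'rV[rat]_m))))))%type.
Definition to_prod x : prod_carrier :=
  (ca x, (cb x, (cz x, (cp x, (cq x, (cw x, cr x)))))).
Definition of_prod (t : prod_carrier) :=
  let: (a, (b, (z, (p, (q, (w, r)))))) := t in Vec a b z p q w r.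
Lemma to_prodK : cancel to_prod of_prod. Proof. by case. Qed.
Lemma of_prodK : cancel of_prod to_prod.
Proof. by case=> [a [b [z [p [q [w r]]]]]]. Qed.
HB.instance Definition _ := Choice.copy carrier (can_type to_prodK).

Definition carrier_add x y := Vec (ca x + ca y) (cb x + cb y) (cz x + cz y)
  (cp x + cp y) (cq x + cq y) (cw x + cw y) (cr x + cr y).
Definition carrier_opp x :=
  Vec (- ca x) (- cb x) (- cz x) (- cp x) (- cq x) (- cw x) (- cr x).
Definition carrier_scale (k : rat) x := Vec (k *: ca x) (k *: cb x) (k *: cz x)
  (k *: cp x) (k *: cq x) (k *: cw x) (k *: cr x).

Lemma carrier_addA : associative carrier_add.
Proof. by move=> x y z; congr Vec; rewrite addrA. Qed.
Lemma carrier_addC : commutative carrier_add.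
Proof. by move=> x y; congr Vec; rewrite addrC. Qed.
Lemma carrier_add0 : left_id (Vec 0 0 0 0 0 0 0) carrier_add.
Proof. by move=> x; apply: carrierP; rewrite /= add0r. Qed.
Lemma carrier_addN : left_inverse (Vec 0 0 0 0 0 0 0) carrier_opp carrier_add.
Proof. by move=> x; congr Vec; rewrite addNr. Qed.
HB.instance Definition _ := GRing.isZmodule.Build carrier
  carrier_addA carrier_addC carrier_add0 carrier_addN.

Lemma carrier_scaleA (a b : rat) x :
  carrier_scale a (carrier_scale b x) = carrier_scale (a * b) x.
Proof. by congr Vec; rewrite scalerA. Qed.
Lemma carrier_scale1 : left_id 1 carrier_scale.
Proof. by move=> x; apply: carrierP; rewrite /= scale1r. Qed.
Lemma carrier_scaleDr : right_distributive carrier_scale +%R.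
Proof. by move=> a x y; congr Vec; rewrite scalerDr. Qed.
Lemma carrier_scaleDl x : {morph carrier_scale^~ x : a b / a + b}.
Proof. by move=> a b; congr Vec; rewrite scalerDl. Qed.
HB.instance Definition _ := GRing.Zmodule_isLmodule.Build rat carrier
  carrier_scaleA carrier_scale1 carrier_scaleDr carrier_scaleDl.

Lemma to_prod_linear : linear to_prod. Proof. by []. Qed.
HB.instance Definition _ :=
  GRing.isLinear.Build rat carrier _ _ to_prod to_prod_linear.

Definition carrier_row x : 'rV[rat]_(\dim {:prod_carrier}) :=
  rVof (vbasis fullv) (to_prod x).
Lemma carrier_row_linear : linear carrier_row.
Proof.
by move=> k x y; rewrite /carrier_row to_prod_linear; apply: rVof_linear.
Qed.
Lemma carrier_row_bij : bijective carrier_row.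
Proof.
exists (of_prod \o vecof (vbasis fullv)) => x /=.
  by rewrite rVofK ?vbasisP // to_prodK.
by rewrite /carrier_row of_prodK vecofK ?vbasisP.
Qed.
Fact carrier_vect_iso : Vector.axiom (\dim {:prod_carrier}) carrier.
Proof.
by exists carrier_row; [apply: carrier_row_linear | apply: carrier_row_bij].
Qed.
HB.instance Definition _ :=
  Lmodule_hasFinDim.Build rat carrier carrier_vect_iso.

Lemma ca_linear : linear ca. Proof. by []. Qed.
Lemma cb_linear : linear cb. Proof. by []. Qed.
Lemma cz_linear : linear cz. Proof. by []. Qed.
Lemma cp_linear : linear cp. Proof. by []. Qed.
Lemma cq_linear : linear cq. Proof. by []. Qed.
Lemma cw_linear : linear cw. Proof. by []. Qed.
Lemma cr_linear : linear cr. Proof. by []. Qed.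
HB.instance Definition _ :=
  GRing.isLinear.Build rat carrier quad _ ca ca_linear.
HB.instance Definition _ :=
  GRing.isLinear.Build rat carrier quad _ cb cb_linear.
HB.instance Definition _ :=
  GRing.isLinear.Build rat carrier quad _ cz cz_linear.
HB.instance Definition _ :=
  GRing.isLinear.Build rat carrier quad _ cp cp_linear.
HB.instance Definition _ :=
  GRing.isLinear.Build rat carrier quad _ cq cq_linear.
HB.instance Definition _ :=
  GRing.isLinear.Build rat carrier quad _ cw cw_linear.
HB.instance Definition _ :=
  GRing.isLinear.Build rat carrier 'rV_m _ cr cr_linear.

(** The coefficients of s, t and st when ([ca x], [cb x]) acts on the R-part of [y], minus the same
    with [x] and [y] exchanged. The Jacobi identity reflects that multiplications in R commute. *)
Definition bracket x y : carrier :=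
  Vec 0 0 0 (ca x * cz y - ca y * cz x) (cb x * cz y - cb y * cz x)
    (ca x * cq y - ca y * cq x + cb x * cp y - cb y * cp x
      + qconj (ca x) * cz y - qconj (ca y) * cz x) 0.

Lemma bracket_alternating x : bracket x x = 0.
Proof. by apply: carrierP => //=; ring. Qed.

Lemma bracket_anti x y : bracket x y = - bracket y x.
Proof. by apply: carrierP; rewrite raddfN /= ?oppr0 //; ring. Qed.

Lemma bracket_jacobi x y z :
  bracket x (bracket y z) + bracket y (bracket z x)
    + bracket z (bracket x y) = 0.
Proof.
by apply: carrierP; rewrite !raddfD /= ?raddf0 ?addr0 //; ring.
Qed.

Lemma bracket_linearr x : linear (bracket x).
Proof.
move=> k y z; apply: carrierP; rewrite linearP /= ?scaler0 ?addr0 //.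
- by rewrite !scale_quadE; ring.
- by rewrite !scale_quadE; ring.
- by rewrite qconj_linear !scale_quadE; ring.
Qed.

Lemma bracket_linearl y : linear (bracket^~ y).
Proof.
move=> k x z; rewrite bracket_anti bracket_linearr opprD -scalerN.
by rewrite -!(bracket_anti _ y).
Qed.

HB.instance Definition _ := bilinear_isBilinear.Build
  rat carrier carrier carrier *:%R *:%R bracket
  (bracket_linearl, bracket_linearr).

Definition nilalg : lieAlgebra rat :=
  @LieAlgebra rat carrier bracket bracket_alternating bracket_jacobi.

Lemma dim_nilalg : \dim (fullv : {vspace nilalg}) = (12 + m)%N.
Proof. by rewrite dimvf /dim /= dimvf -[in RHS](mul1n m). Qed.

End Algebra.

(** * Characteristic polynomials of Anosov automorphisms *)

(** A row-free square [P] is invertible, so [A] and [B] are similar. The sizes are equated by a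
    hypothesis because [\dim {:V}] need not be convertible to the expected dimension. *)
Lemma char_poly_intertwine (F : fieldType) (d n : nat) (A : 'M[F]_d)
    (B : 'M[F]_n) (P : 'M[F]_(d, n)) :
  d = n -> row_free P -> A *m P = P *m B -> char_poly A = char_poly B.
Proof.
move=> eq_dn; case: n / eq_dn B P => B P; rewrite row_free_unit => uP AP.
have eqmx : char_poly_mx A *m map_mx polyC P = map_mx polyC P *m char_poly_mx B.
  by rewrite mulmxBl mulmxBr -!map_mxM AP scalar_mxC.
apply: (mulIf (_ : (\det P)%:P != 0)); first by rewrite polyC_eq0 -unitfE.
rewrite /char_poly -det_map_mx -!det_mulmx eqmx !det_mulmx det_map_mx.
by rewrite -det_map_mx mulrC.
Qed.

Lemma char_poly_lfun_coords (F : fieldType) (V : vectType F) (n : nat)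
    (phi : {linear V -> 'rV[F]_n}) (f : 'End(V)) (B : 'M[F]_n) :
  \dim {:V} = n -> injective phi -> (forall x, phi (f x) = phi x *m B) ->
  char_poly (lfun_matrix f) = char_poly B.
Proof.
move=> dimV inj_phi fB; pose e := vbasis {:V}.
have eB : basis_of {:V} e := vbasisP _.
pose P := lin1_mx (phi \o vecof e).
have PE u : u *m P = phi (vecof e u) by rewrite /P mul_rV_lin1.
apply: (@char_poly_intertwine _ _ _ _ _ P) => //.
  rewrite -kermx_eq0; apply/rowV0P => u /sub_kermxP.
  by rewrite PE -(raddf0 phi) => /inj_phi /eqP; rewrite vecof_eq0 // => /eqP.
apply/row_matrixP => i; rewrite !rowE !mulmxA !PE -fB.
by rewrite (hom_vecof _ eB).
Qed.

Lemma char_poly_lfun_iso (F : fieldType) (V W : vectType F)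
    (phi : {linear V -> W}) (f : 'End(V)) (g : 'End(W)) :
  \dim {:V} = \dim {:W} -> injective phi -> (forall x, phi (f x) = g (phi x)) ->
  char_poly (lfun_matrix f) = char_poly (lfun_matrix g).
Proof.
move=> dimVW inj_phi fg; have eB : basis_of {:W} (vbasis {:W}) := vbasisP _.
apply: (@char_poly_lfun_coords _ _ _ (rVof (vbasis {:W}) \o phi)) => //.
  by apply: inj_comp => //; apply: can_inj (rVofK eB).
by move=> x; rewrite /= fg (rVof_app _ eB).
Qed.

(** In the concatenated coordinates of the two factors, [h] is block diagonal. *)
Lemma char_poly_lfun_pair (F : fieldType) (V W : vectType F) (f : 'End(V))
    (g : 'End(W)) (h : 'End((V * W)%type)) :
  (forall u v, h (u, v) = (f u, g v)) ->
  char_poly (lfun_matrix h) =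
  char_poly (lfun_matrix f) * char_poly (lfun_matrix g).
Proof.
move=> hE; have eV : basis_of {:V} (vbasis {:V}) := vbasisP _.
have eW : basis_of {:W} (vbasis {:W}) := vbasisP _.
pose phi (x : (V * W)%type) :=
  row_mx (rVof (vbasis {:V}) x.1) (rVof (vbasis {:W}) x.2).
have phi_lin : linear phi.
  by move=> k x y; rewrite /phi scale_row_mx add_row_mx -!linearP.
pose phiM := GRing.isLinear.Build _ _ _ _ phi phi_lin.
pose phiL : {linear _ -> _} := HB.pack phi phiM.
rewrite (@char_poly_lfun_coords _ _ _ phiL _
  (block_mx (lfun_matrix f) 0 0 (lfun_matrix g))); first last.
- case=> u v; rewrite hE /= /phi /= mul_row_block !mulmx0 addr0 add0r.
  by rewrite (rVof_app _ eV) (rVof_app _ eW).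
- move=> [u v] [u' v'] /= /eq_row_mx[/= uu' vv'].
  by congr (_, _); [apply: (can_inj (rVofK eV)) |
                    apply: (can_inj (rVofK eW))].
- by rewrite !dimvf.
rewrite /char_poly /char_poly_mx map_block_mx !map_mx0 /=.
rewrite scalar_mx_block opp_block_mx add_block_mx !oppr0 !addr0.
by rewrite det_ublock.
Qed.

(** For a characteristic polynomial the constant coefficient is the determinant up to sign, and
    integrality is carried by the type. The property is stable under products, so it can be checked
    on each block. *)
Definition anosov_poly (p : {poly int}) : Prop :=
  (p`_0 = 1 \/ p`_0 = -1) /\
  forall z : algC, root (map_poly intr p) z -> `|z| != 1.

Lemma anosov_polyM (p q : {poly int}) :
  anosov_poly p -> anosov_poly q -> anosov_poly (p * q).
Proof.
move=> [p0 p_hyp] [q0 q_hyp]; split.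
  rewrite coef0M.
  by case: p0 => ->; case: q0 => ->; [left | right | right | left].
by move=> z; rewrite rmorphM rootM => /orP[/p_hyp | /q_hyp].
Qed.

Lemma anosov_polyP (V : vectType rat) (f : 'End(V)) (p : {poly int}) :
  char_poly (lfun_matrix f) = map_poly intr p -> anosov_poly p ->
  hyperbolic f /\ integer_like f.
Proof.
move=> fp [p0 p_hyp]; split.
  move=> z; rewrite eigenvalue_root_char -map_char_poly fp -map_poly_comp.
  rewrite (eq_map_poly (g := intr)); first exact: p_hyp.
  by move=> a /=; rewrite ratr_int.
split; first by rewrite fp; apply/polyOverP => i; rewrite coef_map intr_int.
have := char_poly_det (lfun_matrix f); rewrite fp coef_map /= -signr_odd.
by case: (odd _); case: p0 => ->; rewrite ?expr1 ?expr0 ?mul1r ?mulN1r;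
  rewrite ?rmorph1 ?rmorphN1; lra.
Qed.

(** One family for both uses: [k = 0] gives the characteristic polynomials of units of norm 1 in K,
    and general [k] serves the abelian summand. *)
Definition trinomial (c : int) (k : nat) : {poly int} :=
  'X^(k.+2) + c *: 'X^(k.+1) + 1.

Lemma size_trinomial c k : size (trinomial c k) = k.+3.
Proof.
rewrite /trinomial -addrA size_polyDl size_polyXn //.
rewrite (leq_ltn_trans (size_polyD _ _)) // gtn_max size_poly1 /= andbT.
by rewrite (leq_ltn_trans (size_scale_leq _ _)) // size_polyXn.
Qed.

Lemma trinomial_monic c k : trinomial c k \is monic.
Proof.
rewrite monicE lead_coefE size_trinomial /= /trinomial !coefD coefZ !coefXn.
by rewrite coef1 eqxx (gtn_eqF (ltnSn _)) mulr0 !addr0.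
Qed.

(* On the unit circle the middle term of the trinomial has modulus at least 3
   and the two others have modulus 1. *)
Lemma anosov_trinomial (c : int) (k : nat) :
  (3 <= `|c|) -> anosov_poly (trinomial c k).
Proof.
move=> c_ge3; split.
  by left; rewrite !coefD coefZ !coefXn coef1 mulr0 !add0r.
move=> z; rewrite /root /trinomial !rmorphD rmorph1 /= map_polyZ /= !map_polyXn.
rewrite !hornerE => /eqP z0; apply/eqP => z1.
have /(congr1 Num.norm) : c%:~R * z ^+ k.+1 = - (z ^+ k.+2 + 1).
  by apply/eqP; rewrite -addr_eq0 addrA [_ * _ + _]addrC z0.
rewrite normrM normrX z1 expr1n mulr1 normrN => cE.
have := ler_normD (z ^+ k.+2) 1; rewrite -cE normrX z1 expr1n normr1.
rewrite -intr_norm -[1 + 1]/(2%:~R) ler_int.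
by move=> /(le_trans c_ge3).
Qed.

Lemma trinomial_mx (c : int) (k : nat) :
  exists C : 'M[rat]_(k.+2), char_poly C = map_poly intr (trinomial c k).
Proof.
have tri_monic : map_poly intr (trinomial c k) \is @monic rat.
  exact/monic_map/trinomial_monic.
(* The companion matrix is generalized so that its size, read off from the polynomial, can be
   rewritten to [k.+2]. *)
have := companionmxK tri_monic; move: (companionmx _).
rewrite size_map_poly_id0 ?(monicP (trinomial_monic _ _)) ?rmorph1 ?oner_eq0 //.
by rewrite size_trinomial => C CE; exists C.
Qed.

(** In the basis 1, l, multiplication by [u] has the trace and norm of [u] as trace and determinant.
    Both lie in Q, so [qcst] loses nothing. *)
Lemma char_poly_quad_mul (u : quad) (t : int) (f : 'End(quad)) :
  qcst (u * qconj u) = 1 -> qcst (u + qconj u) = t%:~R ->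
  (forall x, f x = u * x) ->
  char_poly (lfun_matrix f) = map_poly intr (trinomial (- t) 0).
Proof.
move=> uN ut fE.
pose B : 'M[rat]_2 := \matrix_(i, j) (quad_row (u * [:: 1; qgen]`_i)) 0 j.
rewrite (@char_poly_lfun_coords _ _ _ quad_row f B) ?dimvf //; first last.
- move=> x; rewrite fE; apply/rowP => j.
  rewrite [RHS]mxE big_ord_recl big_ord1 !mxE.
  by case: j => [[|[|//]] ?] /=; ring.
- exact: (bij_inj quad_row_bij).
have trB : \tr B = t%:~R.
  rewrite /mxtrace big_ord_recl big_ord1 !mxE /=.
  by rewrite -[RHS]ut /=; ring.
have detB : \det B = 1.
  rewrite (expand_det_row _ ord0) big_ord_recl big_ord1 /cofactor !det_mx11.
  by rewrite !mxE /= -[RHS]uN /= /bump /=; ring.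
apply/polyP => i; rewrite coef_map /trinomial !coefD coefZ !coefXn coef1 /=.
case: i => [|[|[|i]]].
- by rewrite char_poly_det detB sqrrN expr1n mulr1 mulr0.
- by rewrite (char_poly_trace B) // trB /= mulr1 addr0 add0r mulrNz.
- have /monicP := char_poly_monic B; rewrite lead_coefE size_char_poly /= => ->.
  by rewrite mulr0 !addr0.
- by rewrite mulr0 !addr0 nth_default ?size_char_poly.
Qed.

(** * The automorphism *)

Section PairLfun.
Variables (F : fieldType) (V W : vectType F) (f : 'End(V)) (g : 'End(W)).

Definition pair_map (x : (V * W)%type) : (V * W)%type := (f x.1, g x.2).
Lemma pair_map_linear : linear pair_map.
Proof. by move=> k x y; congr (_, _); rewrite linearP. Qed.
HB.instance Definition _ :=
  GRing.isLinear.Build F (V * W)%type (V * W)%type _ pair_map pair_map_linear.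
Definition pair_lfun : 'End((V * W)%type) := linfun pair_map.

Lemma pair_lfunE u v : pair_lfun (u, v) = (f u, g v).
Proof. by rewrite lfunE. Qed.

End PairLfun.

Section QuadLfun.
Variable u : quad.

Definition mulq (x : quad) : quad := u * x.
Lemma mulq_linear : linear mulq.
Proof. by move=> k x y; rewrite /mulq mulrDr scalerAr. Qed.
HB.instance Definition _ :=
  GRing.isLinear.Build rat quad quad _ mulq mulq_linear.
Definition quad_lfun : 'End(quad) := linfun mulq.
Lemma quad_lfunE x : quad_lfun x = u * x. Proof. by rewrite lfunE. Qed.
End QuadLfun.

Section Automorphism.

Variables (m : nat) (C : 'M[rat]_m).
Hypothesis C_unit : C \in unitmx.

Definition prod_lfun : 'End(prod_carrier m) :=
  pair_lfun (quad_lfun qgen) (pair_lfun (quad_lfun (qconj qgen ^+ 2))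
  (pair_lfun (quad_lfun (qgen ^+ 3)) (pair_lfun (quad_lfun (qgen ^+ 4))
  (pair_lfun (quad_lfun qgen) (pair_lfun (quad_lfun (qgen ^+ 2))
  (linfun (mulmxr C))))))).

(** The exponents of l are 1, -2, 3 on [ca], [cb], [cz]. Compatibility with the bracket forces 1 + 3
    = 4 on [cp] and -2 + 3 = 1 on [cq]. All three kinds of terms in [cw] then scale by l^2: 1 + 1 =
    -2 + 4 = -1 + 3, the last because conj(l) = l^-1. No exponent is 0. *)
Definition autom_fun (x : nilalg m) : nilalg m :=
  Vec (qgen * ca x) (qconj qgen ^+ 2 * cb x) (qgen ^+ 3 * cz x)
     (qgen ^+ 4 * cp x) (qgen * cq x) (qgen ^+ 2 * cw x) (cr x *m C).

Lemma autom_fun_linear : linear autom_fun.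
Proof.
move=> k x y; apply: carrierP => /=; rewrite ?mulmxDl ?scalemxAl //;
  exact: mulq_linear.
Qed.
HB.instance Definition _ :=
  GRing.isLinear.Build rat (nilalg m) (nilalg m) _ autom_fun autom_fun_linear.
Definition autom : 'End(nilalg m) := linfun autom_fun.

Lemma qgen_norm : qgen * qconj qgen = 1. Proof. quad_ring. Qed.

Lemma autom_bijective : bijective autom.
Proof.
have genX k : qgen ^+ k * qconj qgen ^+ k = 1.
  by rewrite -exprMn qgen_norm expr1n.
have conjX k : qconj qgen ^+ k * qgen ^+ k = 1 by rewrite mulrC.
exists (fun x : nilalg m => Vec (qconj qgen * ca x) (qgen ^+ 2 * cb x)
  (qconj qgen ^+ 3 * cz x) (qconj qgen ^+ 4 * cp x) (qconj qgen * cq x)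
  (qconj qgen ^+ 2 * cw x) (cr x *m invmx C)) => x; rewrite lfunE;
  apply: carrierP => /=.
all: by rewrite ?mulrA ?(genX, conjX, qgen_norm, mulrC (qconj qgen) qgen)
  ?qgen_norm ?mul1r ?mulmxK ?mulmxKV.
Qed.

Lemma autom_bracket x y :
  autom (lie_bracket (nilalg m) x y) =
  lie_bracket (nilalg m) (autom x) (autom y).
Proof.
rewrite !lfunE; apply: carrierP => /=.
all: rewrite ?mulr0 ?mul0mx //.
- by ring.
(* The [cq] and [cw] identities depend on l conj(l) = 1, so they are checked on rational
   coordinates. *)
- by rewrite !expr2 !exprS expr0; quad_ring.
- by rewrite !expr2 !exprS expr0; quad_ring.
Qed.

Lemma char_poly_autom :
  char_poly (lfun_matrix autom) = char_poly (lfun_matrix prod_lfun).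
Proof.
apply: (@char_poly_lfun_iso _ _ _ (@to_prod m)).
- by rewrite dim_nilalg dimvf -[in LHS](mul1n m).
- exact: can_inj (@to_prodK m).
by move=> x; rewrite lfunE /= /prod_lfun !pair_lfunE !quad_lfunE lfunE.
Qed.

Lemma autom_anosov (p : {poly int}) :
  char_poly (lfun_matrix (linfun (mulmxr C) : 'End('rV[rat]_m))) =
    map_poly intr p -> anosov_poly p ->
  anosov_automorphism autom.
Proof.
move=> Cp p_anosov.
have charE u t : qcst (u * qconj u) = 1 -> qcst (u + qconj u) = t%:~R ->
  char_poly (lfun_matrix (quad_lfun u)) = map_poly intr (trinomial (- t) 0).
  move=> uN ut; exact: (char_poly_quad_mul uN ut (quad_lfunE u)).
suff [hyp int] : hyperbolic autom /\ integer_like autom.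
  by split=> //; split; [exact: autom_bijective | exact: autom_bracket].
pose tri t := trinomial (- t) 0.
(* The numbers 3, 7, 18, 47 are the traces of l, l^2, l^3, l^4; l^-2 has the same trace as l^2. *)
apply: (@anosov_polyP _ _
  (tri 3 * (tri 7 * (tri 18 * (tri 47 * (tri 3 * (tri 7 * p))))))).
  rewrite char_poly_autom /prod_lfun !(char_poly_lfun_pair (pair_lfunE _ _)).
  rewrite Cp !(charE qgen 3) // (charE (qconj qgen ^+ 2) 7) //.
  rewrite (charE (qgen ^+ 2) 7) //.
  by rewrite (charE (qgen ^+ 3) 18) // (charE (qgen ^+ 4) 47) // !rmorphM.
by rewrite /tri; do 6! (apply: anosov_polyM; first exact: anosov_trinomial).
Qed.

End Automorphism.

(** * Nilpotency *)

(** This lets the lower central series be followed one coordinate at a time. *)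
Lemma lie_prodv_ker (K : fieldType) (L : lieAlgebra K) (V : vectType K)
    (phi : {linear L -> V}) (A B : {vspace L}) :
  (forall x y, x \in A -> y \in B -> phi (lie_bracket L x y) = 0) ->
  forall x, x \in lie_prodv A B -> phi x = 0.
Proof.
move=> phi0 x; suff /subvP sub : (lie_prodv A B <= lker (linfun phi))%VS.
  by move=> /sub; rewrite memv_ker lfunE => /eqP.
apply/span_subvP => _ /allpairsP[[u v] /= [/vbasis_mem uA /vbasis_mem vB ->]].
by rewrite memv_ker lfunE /= phi0.
Qed.

Lemma nilalg_nilpotent m : lie_nilpotent (nilalg m).
Proof.
(* The coordinates [ca], [cb], [cz] vanish from term 1 of the series on, [cp] and [cq] from term 2
   on, and term 3 is zero. *)
have c0 k (x : nilalg m) : x \in lower_central (nilalg m) k.+1 ->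
    [/\ ca x = 0, cb x = 0 & cz x = 0].
  by move=> xk; split; move: x xk;
    [apply: (@lie_prodv_ker _ (nilalg m) _ (@ca m)) |
     apply: (@lie_prodv_ker _ (nilalg m) _ (@cb m)) |
     apply: (@lie_prodv_ker _ (nilalg m) _ (@cz m))].
have c1 k (x : nilalg m) :
    x \in lower_central (nilalg m) k.+2 -> cp x = 0 /\ cq x = 0.
  by move=> xk; split; move: x xk;
    [apply: (@lie_prodv_ker _ (nilalg m) _ (@cp m)) |
     apply: (@lie_prodv_ker _ (nilalg m) _ (@cq m))];
    move=> u v _ /c0[av bv zv]; rewrite /= ?av ?bv ?zv; ring.
exists 3%N; apply/eqP; rewrite -subv0; apply/subvP => x x3; rewrite memv0.
apply/eqP; move: x x3; apply: (@lie_prodv_ker _ (nilalg m) _ idfun) => u v _ v2.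
have [av bv zv] := c0 1 _ v2; have [pv qv] := c1 0 _ v2.
by apply: carrierP => //=; rewrite ?av ?bv ?zv ?pv ?qv ?raddf0; ring.
Qed.

(** * Gradings and derivations *)

Section Grading.

Variables (K : fieldType) (L : lieAlgebra K) (n_ : nat -> {vspace L}).
Hypothesis gr : positive_grading n_.

Let S N : {vspace L} := (\sum_(i < N) n_ i)%VS.

(** A bound that works for the finitely many vectors of a basis works for all of [L]. *)
Lemma grading_full : exists N, forall x : L, x \in S N.
Proof.
have [_ span _ _] := gr.
have S_mono N M : (N <= M)%N -> (S N <= S M)%VS.
  move=> leNM; apply/subv_sumP => i _.
  exact: (sumv_sup (widen_ord leNM i)).
have bounded (s : seq L) : exists N, forall x, x \in s -> x \in S N.
  elim: s => [|x s [N NP]]; first by exists 0%N.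
  have [M xM] := span x; exists (maxn N M) => y.
  rewrite inE => /predU1P[-> | /NP yN].
    exact: subvP (S_mono _ _ (leq_maxr N M)) _ xM.
  exact: subvP (S_mono _ _ (leq_maxl N M)) _ yN.
have [N NP] := bounded (vbasis {:L}).
exists N => x; apply: (subvP (_ : {:L} <= S N)%VS); last exact: memvf.
by rewrite -(span_basis (vbasisP {:L})); apply/span_subvP.
Qed.

(** The operator is the sum of [i] times the projection to [n_ i], in the direct sum of the first
    [N] components. *)
Lemma grading_operator N :
  exists D : 'End(L), forall i x, (i < N)%N -> x \in n_ i -> D x = i%:R *: x.
Proof.
have [/(_ N) dir _ _ _] := gr.
pose D : 'End(L) := \sum_(i < N) i%:R *: sumv_pi_for (erefl (S N)) i.
exists D => i x ltiN xi; pose j := Ordinal ltiN.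
have xS : x \in S N by apply: subvP (sumv_sup j _ (subvv _)) _ xi.
have sum_x := sumv_pi_sum (erefl (S N)) xS.
have : \sum_i sumv_pi_for (erefl (S N)) i x == \sum_i (if i == j then x else 0).
  by rewrite sum_x -big_mkcond big_pred1_eq.
rewrite (directv_sum_unique dir) => [/forall_inP xE|i0 _|i0 _]; first last.
- by case: eqP => [->|_]; rewrite ?mem0v.
- exact: memv_sum_pi.
rewrite sum_lfunE (bigD1 j) //= scale_lfunE (eqP (xE j isT)) eqxx.
rewrite big1 ?addr0 //.
by move=> k /negPf nkj; rewrite scale_lfunE (eqP (xE k isT)) nkj scaler0.
Qed.

(** Multiplication by the degree is a derivation because degrees add under the bracket. The last
    clause keeps the positivity of the grading: a nonzero component has a nonzero eigenvalue. *)
Lemma grading_derivation : exists (N : nat) (D : 'End(L)),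
  (forall x y : L, D (lie_bracket L x y) =
     lie_bracket L (D x) y + lie_bracket L x (D y)) /\
  forall x : L, exists2 xs : 'I_N -> L, x = \sum_i xs i &
    forall i, D (xs i) = i%:R *: xs i /\ (i = 0%N :> nat -> xs i = 0).
Proof.
have [_ _ n0 brk] := gr; have [N full] := grading_full.
(* A bracket of components of degrees below [N] has degree below [N + N], where [D] must still act
   by the degree. *)
have [D DE] := grading_operator (N + N).
have homog i x : (i < N)%N -> x \in n_ i -> D x = i%:R *: x.
  by move=> ltiN; apply: DE; rewrite (leq_trans ltiN) ?leq_addr.
exists N, D; split=> [x y|x].
  have /memv_sumP[xs xsP ->] := full x; have /memv_sumP[ys ysP ->] := full y.
  set y' := \sum_i ys i; rewrite [D (\sum_i xs i)]linear_sum !linear_sumlz.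
  rewrite linear_sum -big_split; apply: eq_bigr => i _ /=.
  rewrite [D y']linear_sum !linear_sumr linear_sum -big_split.
  apply: eq_bigr => j _ /=.
  rewrite (homog i (xs i)) ?xsP // (homog j (ys j)) ?ysP //.
  rewrite (DE (i + j)%N) ?brk ?xsP ?ysP //; last first.
    by rewrite -addnS leq_add // ltnW.
  by rewrite linearZl_LR linearZr_LR -scalerDl natrD.
have /memv_sumP[xs xsP ->] := full x; exists xs => // i.
split; first by rewrite (homog i) ?xsP.
by move=> i0; apply/eqP; rewrite -memv0 -n0 -i0 xsP.
Qed.

End Grading.

(** * Derivations of the example *)

Section Derivation.

Variables (m : nat) (D : 'End(nilalg m)).
Hypothesis D_bracket : forall x y : carrier m,
  D (bracket x y) = bracket (D x) y + bracket x (D y).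

Let ia (s : quad) : carrier m := Vec s 0 0 0 0 0 0.
Let ib (s : quad) : carrier m := Vec 0 s 0 0 0 0 0.
Let iz (s : quad) : carrier m := Vec 0 0 s 0 0 0 0.
Let ip (s : quad) : carrier m := Vec 0 0 0 s 0 0 0.
Let iq (s : quad) : carrier m := Vec 0 0 0 0 s 0 0.
Let iw (s : quad) : carrier m := Vec 0 0 0 0 0 s 0.

Let bracket_az s t : bracket (ia s) (iz t) = ip (s * t) + iw (qconj s * t).
Proof. by apply: carrierP => /=; rewrite ?raddf0 ?addr0 //; ring. Qed.
Let bracket_bz s t : bracket (ib s) (iz t) = iq (s * t).
Proof. by apply: carrierP => //=; rewrite ?raddf0; ring. Qed.
Let bracket_aq s t : bracket (ia s) (iq t) = iw (s * t).
Proof. by apply: carrierP => //=; rewrite ?raddf0; ring. Qed.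
Let bracket_ap s t : bracket (ia s) (ip t) = 0.
Proof. by apply: carrierP => //=; rewrite ?raddf0; ring. Qed.

(** A derivation sends a bracket to a sum of brackets, and [iq s] is a bracket. The next two facts
    use the same argument for [iw s] and [ip s]. *)
Let Dq0 s : [/\ ca (D (iq s)) = 0, cb (D (iq s)) = 0 & cz (D (iq s)) = 0].
Proof.
by rewrite -[s]mul1r -bracket_bz D_bracket; split; rewrite /= addr0.
Qed.

Let Dw0 s : [/\ ca (D (iw s)) = 0, cb (D (iw s)) = 0, cz (D (iw s)) = 0,
  cp (D (iw s)) = 0 & cq (D (iw s)) = 0].
Proof.
have [a0 b0 z0] := Dq0 s.
rewrite -[s]mul1r -bracket_aq D_bracket; split; rewrite /= ?addr0 //.
  by rewrite z0; ring.
by rewrite z0; ring.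
Qed.

Let Dp0 s : [/\ ca (D (ip s)) = 0, cb (D (ip s)) = 0 & cz (D (ip s)) = 0].
Proof.
have [a0 b0 z0 _ _] := Dw0 s.
have -> : ip s = bracket (ia 1) (iz s) - iw s.
  by rewrite bracket_az rmorph1 !mul1r addrK.
by rewrite linearB /= D_bracket a0 b0 z0; split; rewrite /= subr0 addr0.
Qed.

(** Such an [x] commutes with [ip 1] and [iq 1]. Applying [D] to these two relations, the st
    coefficients are [cb (D x)] and [ca (D x)], since the other terms vanish. *)
Let D_module x : ca x = 0 -> cb x = 0 -> ca (D x) = 0 /\ cb (D x) = 0.
Proof.
move=> a0 b0; have [pa pb pz] := Dp0 1; have [qa qb qz] := Dq0 1.
have xp : bracket x (ip 1) = 0.
  by apply: carrierP => //=; rewrite ?a0 ?b0 ?raddf0; ring.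
have xq : bracket x (iq 1) = 0.
  by apply: carrierP => //=; rewrite ?a0 ?b0 ?raddf0; ring.
split.
  have := congr1 (@cw m) (D_bracket x (iq 1)); rewrite xq linear0 /=.
  by rewrite a0 b0 qa qb qz !raddf0 => e; rewrite [RHS]e; ring.
have := congr1 (@cw m) (D_bracket x (ip 1)); rewrite xp linear0 /=.
by rewrite a0 b0 pa pb pz !raddf0 => e; rewrite [RHS]e; ring.
Qed.

(** The derivation rule on [ia s] and [iz t], coefficient by coefficient; [Bz], [Aq] and [Ap] treat
    the other pairs of lines. *)
Let Az s t :
  [/\ cp (D (ip (s * t))) = ca (D (ia s)) * t + s * cz (D (iz t)),
      cq (D (ip (s * t))) = cb (D (ia s)) * t &
      cw (D (ip (s * t))) + cw (D (iw (qconj s * t))) =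
        qconj (ca (D (ia s))) * t + s * cq (D (iz t))
          + qconj s * cz (D (iz t))].
Proof.
have [_ _ _ pw qw] := Dw0 (qconj s * t).
have [az bz] := @D_module (iz t) erefl erefl.
have := D_bracket (ia s) (iz t); rewrite bracket_az linearD /= => e.
split; [have := congr1 (@cp m) e | have := congr1 (@cq m) e
       | have := congr1 (@cw m) e]; rewrite /= ?pw ?qw ?az ?bz ?raddf0 ?addr0.
all: by move=> ->; ring.
Qed.

Let Bz s t : cq (D (iq (s * t))) = cb (D (ib s)) * t + s * cz (D (iz t)).
Proof.
have [az bz] := @D_module (iz t) erefl erefl.
have := congr1 (@cq m) (D_bracket (ib s) (iz t)).
rewrite bracket_bz /= bz => ->.
by ring.
Qed.

Let Aq s t : cw (D (iw (s * t))) = ca (D (ia s)) * t + s * cq (D (iq t)).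
Proof.
have [aq bq zq] := Dq0 t.
have := congr1 (@cw m) (D_bracket (ia s) (iq t)).
rewrite bracket_aq /= aq bq zq !raddf0 => ->; by ring.
Qed.

Let Ap s t : 0 = cb (D (ia s)) * t + s * cq (D (ip t)).
Proof.
have [ap bp zp] := Dp0 t.
have := congr1 (@cw m) (D_bracket (ia s) (ip t)).
rewrite bracket_ap linear0 /= ap bp zp !raddf0 => ->; by ring.
Qed.

Let quad_natmul_inj (k : nat) (s : quad) : s *+ k.+1 = 0 -> s = 0.
Proof.
rewrite -scaler_nat => /eqP; rewrite scaler_eq0 pnatr_eq0 => /eqP //.
Qed.

(** By [Az], [cb (D (ia s)) * t] depends only on the product of [s] and [t], so it equals c s t with
    c = [cb (D (ia 1))]. The relation [[ia 1], [ip 1]] = 0 then gives 2 c = 0. *)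
Let Dab s : cb (D (ia s)) = 0.
Proof.
have [_ q1 _] := Az s 1; have [_ qs _] := Az 1 s.
have [_ q11 _] := Az 1 1; rewrite !mulr1 ?mul1r in q1 qs q11.
have c0 : cb (D (ia 1)) = 0.
  apply: (@quad_natmul_inj 1); have := Ap 1 1.
  by rewrite q11 !mulr1 mul1r mulr2n => /esym.
by rewrite -q1 qs c0 mul0r.
Qed.

(* The map h below is a Q-linear derivation of the field K, hence zero. *)
Let Dzz r : cz (D (iz r)) = cz (D (iz 1)) * r.
Proof.
pose h s := cz (D (iz s)) - cz (D (iz 1)) * s.
have hM s t : h (s * t) = h s * t + s * h t.
  have [e1 _ _] := Az s t; have [e2 _ _] := Az 1 (s * t).
  have [e3 _ _] := Az s 1; have [e4 _ _] := Az 1 s.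
  rewrite ?mul1r ?mulr1 in e1 e2 e3 e4; rewrite /h.
  have -> : cz (D (iz (s * t))) = cp (D (ip (s * t))) - ca (D (ia 1)) * (s * t).
    by rewrite e2; ring.
  rewrite e1.
  have -> : ca (D (ia s)) = cp (D (ip s)) - s * cz (D (iz 1)).
    by rewrite e3; ring.
  by rewrite e4; ring.
have h_lin k s t : h (k *: s + t) = k *: h s + h t.
  rewrite /h (_ : iz _ = k *: iz s + iz t); last first.
    by apply: carrierP; rewrite /= ?scaler0 ?addr0.
  by rewrite linearP /= !scale_quadE; ring.
have h1 : h 1 = 0 by rewrite /h; ring.
have h0 : h 0 = 0 by rewrite /h (_ : iz 0 = 0) // linear0 /=; ring.
have hgen : h qgen = 0.
  have := hM qgen qgen.
  have -> : qgen * qgen = 3 *: qgen + (-1) *: 1 by quad_ring.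
  rewrite h_lin -[(-1) *: 1]addr0 h_lin h1 h0 scaler0 !addr0 => e.
  (* Applying [h] to l^2 = 3 l - 1 gives (2 l - 3) h(l) = 0; multiply by 2 l - 3, whose square is
     5. *)
  have e5 : h qgen *+ 5 = 0.
    have -> : h qgen *+ 5 =
        (qgen *+ 2 - 3) * ((h qgen * qgen + qgen * h qgen) - 3 *: h qgen).
      rewrite scale_quadE; quad_ring.
    by rewrite -e subrr mulr0.
  exact: quad_natmul_inj e5.
have -> : r = qcst r *: 1 + (qlin r *: qgen + 0) by quad_ring.
have : h (qcst r *: 1 + (qlin r *: qgen + 0)) = 0.
  by rewrite !h_lin h1 hgen h0 !scaler0 !addr0.
by move=> /eqP; rewrite subr_eq0 => /eqP.
Qed.

Lemma derivation_cb :
  exists2 B : quad, qconj B = - B & forall x, cb (D x) = B * cb x.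
Proof.
pose g := cz (D (iz 1)); pose A := ca (D (ia 1)); pose B := cb (D (ib 1)).
have Daa s : ca (D (ia s)) = A * s.
  have [e1 _ _] := Az s 1; have [e2 _ _] := Az 1 s.
  rewrite ?mul1r ?mulr1 in e1 e2; move: e1; rewrite e2 Dzz => e.
  by apply: (addIr (s * g)); rewrite -e; ring.
have Dqq s : cq (D (iq s)) = (B + g) * s.
  by have := Bz 1 s; rewrite ?mul1r => ->; rewrite Dzz; ring.
have Dbb s : cb (D (ib s)) = B * s.
  have := Bz s 1; rewrite ?mulr1 Dqq => e.
  by apply: (addIr (s * g)); rewrite -e; ring.
have Dww s : cw (D (iw s)) = (A + B + g) * s.
  by have := Aq 1 s; rewrite ?mul1r Dqq => ->; rewrite -/A; ring.
(* The defect [e] measures the failure of conj(A) = A + B. It appears in the st coefficient [E],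
   where [nu] and the [cq] part of [D] on the [iz] line are still unknown. *)
pose e := A + B - qconj A; pose nu s := cw (D (ip s)).
have E s t : nu (s * t) + e * (qconj s * t) = s * cq (D (iz t)).
  have [_ _] := Az s t; rewrite Dww Daa Dzz -/g rmorphM /= => E.
  have : nu (s * t) = qconj A * qconj s * t + s * cq (D (iz t)) +
    qconj s * (g * t) - (A + B + g) * (qconj s * t) by rewrite -E; ring.
  by move=> ->; rewrite /e; ring.
have kappaE t : cq (D (iz t)) = nu t + e * t.
  by have := E 1 t; rewrite rmorph1 !mul1r => ->.
have nuE s : nu s = s * nu 1 + e * (s - qconj s).
  have := E s 1; rewrite kappaE !mulr1 => E1; apply: (addIr (e * qconj s)).
  by rewrite E1; ring.
have e0 : e = 0.
  (* Eliminating nu and cq (D (iz _)) from E leaves e * (l - conj l) ^ 2 = 0,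
     where (l - conj l) ^ 2 = 5. *)
  apply: (@quad_natmul_inj 4); have := E qgen qgen.
  rewrite kappaE nuE (nuE qgen) => E1.
  transitivity (qgen * (qgen * nu 1 + e * (qgen - qconj qgen) + e * qgen)
    - (qgen * qgen * nu 1 + e * (qgen * qgen - qconj (qgen * qgen))
       + e * (qconj qgen * qgen))).
    by quad_ring.
  by rewrite -E1; ring.
have BE : B = qconj A - A by rewrite -[LHS]subr0 -e0 /e; ring.
exists B; first by rewrite BE; quad_ring.
move=> x; have -> : x = ia (ca x) + (ib (cb x) +
    Vec 0 0 (cz x) (cp x) (cq x) (cw x) (cr x)).
  by apply: carrierP; rewrite /= ?addr0 ?add0r.
have DD u v : D (u + v) = D u + D v by rewrite linearD.
rewrite !DD /= Dab Dbb !add0r addr0.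
have [//|//|_ ->] :=
  @D_module (Vec 0 0 (cz x) (cp x) (cq x) (cw x) (cr x)).
by rewrite addr0.
Qed.

End Derivation.

(** * Absence of positive gradings and conclusion *)

Lemma sqr_rat_neq5 (x : rat) : x ^+ 2 != 5.
Proof.
apply/eqP => x5.
have : ((numq x) ^+ 2)%:~R = (5 * denq x ^+ 2)%:~R :> rat.
  by rewrite rmorphXn /= numqE exprMn x5 rmorphM rmorphXn.
move=> /intr_inj /(congr1 absz); rewrite abszM !abszX.
(* The 5-adic valuation is even on the left and odd on the right. *)
move=> /(congr1 (fun n => odd (logn 5 n))).
rewrite lognM ?expn_gt0 ?absz_gt0 ?denq_neq0 // !lognX.
by rewrite -[logn 5 `|5|]/1%N !mul2n add1n /= !odd_double.
Qed.

Lemma nilalg_not_graded m :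
  ~ exists n_ : nat -> {vspace nilalg m}, positive_grading n_.
Proof.
case=> n_ /grading_derivation[N [D [D_bracket decomp]]].
have [B BN DB] := derivation_cb D_bracket.
pose x : nilalg m := Vec 0 1 0 0 0 0 0; have [xs x_sum xsP] := decomp x.
have [i bi] : exists i, cb (xs i) != 0.
  case: (pickP (fun i => cb (xs i) != 0)) => [i bi|b0]; first by exists i.
  have := congr1 (@cb m) x_sum; rewrite raddf_sum /= big1 => [/eqP //|i _].
  by apply/eqP; rewrite -[_ == _]negbK b0.
have [Di i0] := xsP i; have i_neq0 : i%:R != 0 :> rat.
  rewrite pnatr_eq0; apply: contra_neq bi => /i0 ->; exact: raddf0.
have := DB (xs i); rewrite Di => /= Bb.
(* Trace 0 means 2 [qcst B] + 3 s = 0. *)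
pose s := qlin B; have Bs : B = (s / 2) *: (qgen *+ 2 - 3).
  have := congr1 qcst BN => /= B0; apply: quadP => /=; rewrite /s; lra.
(* Here B^2 = 5 s^2 / 4, while B multiplies the nonzero element [cb (xs i)] by i. Hence 2 i / s
   would be a rational square root of 5. *)
have : (i%:R ^+ 2 - 5 / 4 * s ^+ 2) *: cb (xs i) = 0.
  transitivity (i%:R *: (i%:R *: cb (xs i)) - B * (B * cb (xs i))).
    by rewrite Bs; apply: quadP => /=; field.
  by rewrite -Bb -scalerAr -Bb subrr.
move=> /eqP; rewrite scaler_eq0 (negPf bi) orbF subr_eq0 => /eqP is2.
have s0 : s != 0.
  by apply: contraNneq i_neq0 => s0; rewrite -sqrf_eq0 is2 s0 expr0n mulr0.
have /eqP[] := sqr_rat_neq5 (2 * i%:R / s).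
by rewrite !exprMn is2; field.
Qed.

Theorem corollary4p8 (n : nat) (n_ge14 : (14 <= n)%N) :
  exists L : lieAlgebra rat,
    [/\ \dim (fullv : {vspace L}) = n,
        anosov_lie_algebra L &
        ~ exists n_ : nat -> {vspace L}, positive_grading n_].
Proof.
(* The abelian summand has dimension n - 12 = k + 2, the degree of [trinomial 3 k]. *)
rewrite -(subnKC n_ge14); set k := (n - 14)%N; exists (nilalg k.+2); split.
- by rewrite dim_nilalg.
- split; first exact: nilalg_nilpotent.
  have [C CE] := trinomial_mx 3 k.
  have C_unit : C \in unitmx.
    have := char_poly_det C; rewrite CE coef_map /= => detC.
    rewrite unitmxE unitfE; apply/eqP => C0; move: detC; rewrite C0 mulr0.
    by have [[-> | ->] _] := @anosov_trinomial 3 k isT.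
  exists (autom C); apply: (autom_anosov C_unit (p := trinomial 3 k));
    last exact: anosov_trinomial.
  rewrite -CE; apply: (@char_poly_lfun_coords _ _ _ idfun) => //.
    by rewrite dimvf /dim /= mul1n.
  by move=> x; rewrite lfunE.
- exact: nilalg_not_graded.
Qed.
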